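(* Let $k\ge 2$ be a fixed integer and assume the Unbalanced Supersaturation Conjecture for this $k$: there is a constant $c_k>0$ such that every bipartite graph with bipartition $A\sqcup B$, $m$ edges and $t$ cycles of length $2k$, with $m\ge 100k(|A|+|B|+(|A||B|)^{(k+1)/(2k)})$, satisfies $t\ge c_k\, m^{2k}/(|A|^k|B|^k)$. Let $G$ be a graph with $m$ edges, $t$ cycles of length $2k$, and maximum degree $\Delta(G)\le m^{2/(k+1)}$. Then the number of capped $k$-walks in $G$ is at most $\widetilde{O}(m^{2k/(k+1)}+t)$.
   Context: Fix a total order $\succ$ on the vertices of $G$ such that $u\succ w$ whenever $\deg(u)>\deg(w)$ (ties broken arbitrarily). A $k$-walk is a walk $x_0,x_1,\ldots,x_k$ with $k$ edges; it is capped if $x_0\succ x_i$ for all $i\in\{1,\ldots,k\}$. $\widetilde{O}$ hides polylogarithmic factors in the number of vertices and constants depending on $k$. *)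

(* Defs.v *)
From mathcomp Require Import all_boot all_order all_algebra.
From mathcomp Require Import reals exp.

Set Implicit Arguments.
Unset Strict Implicit.
Unset Printing Implicit Defensive.

Import Order.TTheory GRing.Theory Num.Theory.
Local Open Scope ring_scope.

Record sgraph := SGraph {
  vertex :> finType;
  adj : rel vertex;
  adj_sym : symmetric adj;
  adj_irrefl : irreflexive adj
}.

Section Graph.
Variable G : sgraph.

Definition edges : {set {set G}} :=
  [set [set p.1; p.2] | p : G * G & adj p.1 p.2].

Definition num_edges : nat := #|edges|.

Definition deg (x : G) : nat := #|[set y : G | adj x y]|.

Definition max_deg : nat := \max_(x : G) deg x.

Definition cycle_edges (c : seq G) : {set {set G}} :=
  [set [set x; next c x] | x in c].

(* Cycles are counted as subgraphs, each identified with its edge set: a cycle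
   of length l >= 3 is counted once and not 2l times. *)
Definition num_cycles (l : nat) : nat :=
  #|[set cycle_edges c | c : l.-tuple G & ucycleb (@adj G) c]|.

Definition bipartition (A B : {set G}) : Prop :=
  [/\ A :&: B = set0, A :|: B = [set: G] &
      forall x y : G, adj x y -> (x \in A) = (y \in B)].

(* [succ x y] is to be read x ≻ y. *)
Definition degree_order (succ : rel G) : Prop :=
  [/\ irreflexive succ, transitive succ,
      forall x y : G, x != y -> succ x y || succ y x &
      forall u w : G, (deg w < deg u)%N -> succ u w].

(* A k-walk x_0, x_1, ..., x_k is the pair (x_0, [x_1; ...; x_k]). *)
Definition num_capped_walks (succ : rel G) (k : nat) : nat :=
  #|[set w : G * k.-tuple G |
      path (@adj G) w.1 w.2 && all (succ w.1) w.2]|.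

End Graph.

Definition unbalanced_supersaturation (R : realType) (k : nat) : Prop :=
  exists c : R, 0 < c /\
    forall (G : sgraph) (A B : {set G}), bipartition A B ->
      let m : R := (num_edges G)%:R in
      let t : R := (num_cycles G (2 * k))%:R in
      let a : R := #|A|%:R in
      let b : R := #|B|%:R in
      100 * k%:R * (a + b + (a * b) `^ (k.+1%:R / (2 * k)%:R)) <= m ->
      c * (m ^+ (2 * k) / (a ^+ k * b ^+ k)) <= t.

(* Main.v *)
Require Import Defs.
From mathcomp Require Import all_boot all_order all_algebra.
From mathcomp Require Import reals exp.
From mathcomp Require Import lra.

Set Implicit Arguments.
Unset Strict Implicit.
Unset Printing Implicit Defensive.

Import Order.TTheory GRing.Theory Num.Theory.
Local Open Scope ring_scope.

(** Let X be the adjacency operator of G. If x_0 caps the walk x_0, ..., x_k then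
    deg x_(k-1) <= deg x_0, so the deg x_(k-1) choices of x_k number at most
    sqrt (deg x_0 * deg x_(k-1)); hence the capped k-walks are at most
    <sqrt deg, X^(k-1) sqrt deg>, which is bounded by ||X||^(k-1) times the sum of
    the degrees.

    Put q = m^(1/(k+1)) and tau = t^(1/(2k)). Supersaturation, together with
    e(A, B) <= m and the degree bound q^2, gives
    e(A, B) <= O(q + tau) sqrt (|A| |B|) for disjoint A and B, and averaging over
    cuts removes disjointness. A dyadic decomposition turns this estimate on
    indicator functions into ||X|| <= O((log n)^2 (q + tau)). Finally
    m (q + tau)^(k-1) <= O(q^(2k) + tau^(2k)) because m = q^(k+1). *)

(** * Ordered adjacent pairs between two sets, and random cuts *)

Section CrossPairs.
Local Open Scope nat_scope.
Variable G : sgraph.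
Implicit Types A B P : {set G}.

(** The cardinality is <1_A, X 1_B>: an edge inside A ∩ B counts twice. *)
Definition cross_pairs A B : {set G * G} :=
  [set p | [&& p.1 \in A, p.2 \in B & adj p.1 p.2]].

Lemma card_cross_pairs A B :
  #|cross_pairs A B| = \sum_(x in A) \sum_(y in B) adj x y.
Proof.
rewrite -sum1_card pair_big /= big_mkcond [RHS]big_mkcond /=.
apply: eq_bigr => -[x y] _; rewrite inE /=.
by case: (x \in A); case: (y \in B); case: (adj x y).
Qed.

Lemma cross_pairsC A B : #|cross_pairs A B| = #|cross_pairs B A|.
Proof.
rewrite !card_cross_pairs exchange_big /=.
by apply: eq_bigr => x _; apply: eq_bigr => y _; rewrite adj_sym.
Qed.

Lemma degE (x : G) : deg x = \sum_y adj x y.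
Proof.
rewrite /deg -sum1dep_card big_mkcond /=.
by apply: eq_bigr => y _; case: (adj x y).
Qed.

Lemma cross_pairs_le_deg A B : #|cross_pairs A B| <= max_deg G * #|A|.
Proof.
rewrite card_cross_pairs mulnC -sum_nat_const; apply: leq_sum => x _.
apply: leq_trans (leq_bigmax x); rewrite degE.
by rewrite [leqRHS](bigID (mem B)) /= leq_addr.
Qed.

Lemma sum_deg : \sum_(x : G) deg x = #|cross_pairs setT setT|.
Proof.
rewrite card_cross_pairs; apply: eq_big => [x|x _]; first by rewrite inE.
by rewrite degE; apply: eq_bigl => y; rewrite inE.
Qed.

(** Disjointness fixes which endpoint of an edge lies in A, so forgetting the order of a crossing
    pair is injective. *)
Lemma cross_pairs_le_edges A B :
  A :&: B = set0 -> #|cross_pairs A B| <= num_edges G.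
Proof.
move=> AB0; have dis z : z \in A -> z \in B -> False.
  by move=> zA zB; have := in_set0 z; rewrite -AB0 inE zA zB.
have inj : {in cross_pairs A B &,
    injective (fun p : G * G => [set p.1; p.2])}.
  move=> [x y] [x' y']; rewrite !inE /= => /and3P[xA yB _] /and3P[x'A y'B _].
  move=> /setP E; move: (E x) (E y); rewrite !inE !eqxx orbT /= => Ex Ey.
  case/esym/orP: Ex => /eqP Ex; last by case: (dis x xA); rewrite Ex.
  case/esym/orP: Ey => /eqP Ey; first by case: (dis y _ yB); rewrite Ey.
  by rewrite Ex Ey.
rewrite -(card_in_imset inj); apply/subset_leq_card/subsetP => e.
case/imsetP=> p; rewrite inE => /and3P[_ _ ap] ->.
by apply/imsetP; exists p; rewrite ?inE.
Qed.

(** Toggling the membership of x, or of y, is an involution on cuts, so the four membership patterns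
    of (x, y) are equally frequent. *)
Lemma card_cuts (x y : G) : x != y ->
  4 * \sum_(P : {set G}) ((x \in P) && (y \notin P)) = #|{: {set G}}|.
Proof.
move=> xy; pose tog z P : {set G} := [set w | (w \in P) (+) (w == z)].
have togK z : involutive (tog z).
  by move=> P; apply/setP=> w; rewrite !inE addbK.
have togE z w P : (w \in tog z P) = (w \in P) (+) (w == z) by rewrite inE.
have yx : (y == x) = false by rewrite eq_sym; apply/negbTE.
have E z (F : {set G} -> nat) : \sum_P F P = \sum_P F (tog z P).
  by rewrite (reindex_inj (inv_inj (togK z))).
have E1 : \sum_(P : {set G}) ((x \in P) && (y \notin P)) =
          \sum_(P : {set G}) ((x \notin P) && (y \notin P)).
  rewrite (E x); apply: eq_bigr => P _.
  by rewrite !togE eqxx yx addbT addbF.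
have E2 : \sum_(P : {set G}) ((x \in P) && (y \notin P)) =
          \sum_(P : {set G}) ((x \in P) && (y \in P)).
  rewrite (E y); apply: eq_bigr => P _.
  by rewrite !togE eqxx (negbTE xy) addbT addbF negbK.
have E3 : \sum_(P : {set G}) ((x \in P) && (y \in P)) =
          \sum_(P : {set G}) ((x \notin P) && (y \in P)).
  rewrite (E x); apply: eq_bigr => P _.
  by rewrite !togE eqxx yx addbT addbF.
transitivity (\sum_(P : {set G}) ((x \in P) && (y \notin P)) +
    (\sum_(P : {set G}) ((x \notin P) && (y \notin P)) +
    (\sum_(P : {set G}) ((x \in P) && (y \in P)) +
     \sum_(P : {set G}) ((x \notin P) && (y \in P))))).
  by rewrite -E3 -E2 -E1 !mulSn mul0n addn0.
rewrite -!big_split -sum1_card /=; apply: eq_bigr => P _.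
by case: (x \in P); case: (y \in P).
Qed.

(* Averaging over a uniformly random cut [P], each ordered pair crosses it with
   probability 1/4. *)
Lemma cross_pairs_cut A B : exists P,
  #|cross_pairs A B| <= 4 * #|cross_pairs (A :&: P) (B :\: P)|.
Proof.
have E : \sum_(P : {set G}) 4 * #|cross_pairs (A :&: P) (B :\: P)| =
         #|{: {set G}}| * #|cross_pairs A B|.
  transitivity (\sum_(p in cross_pairs A B)
      4 * \sum_(P : {set G}) ((p.1 \in P) && (p.2 \notin P))).
    rewrite -!big_distrr /= exchange_big; congr (4 * _).
    apply: eq_bigr => P _; rewrite -sum1_card.
    rewrite big_mkcond [RHS]big_mkcond; apply: eq_bigr => -[x y] _.
    rewrite !inE /=.
    by do 2!case: (_ \in P); case: (x \in A); case: (y \in B); case: (adj x y).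
  rewrite mulnC -sum_nat_const; apply: eq_bigr => -[x y]; rewrite inE /=.
  case/and3P=> _ _ axy; apply: card_cuts; apply/eqP => xy.
  by move: axy; rewrite xy adj_irrefl.
have cpos : 0 < #|{: {set G}}| by apply/card_gt0P; exists set0.
apply/existsP; apply: contraT; rewrite negb_exists => /forallP lt.
suff : #|{: {set G}}| * #|cross_pairs A B| < #|{: {set G}}| * #|cross_pairs A B|.
  by rewrite ltnn.
rewrite -{1}E -sum_nat_const; apply: (@leq_trans (\sum_(P : {set G}) #|cross_pairs A B|)) => //.
(* Any cut would do here: one term must be split off to make the sum strictly smaller. *)
rewrite (bigD1 set0) //= [leqRHS](bigD1 set0) //= -addSn leq_add //.
  by rewrite ltnNge lt.
by apply: leq_sum => P _; rewrite ltnW // ltnNge lt.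
Qed.

End CrossPairs.

(** * The bipartite graph between two disjoint sets *)

Section BipartiteSubgraph.
Local Open Scope nat_scope.
Variables (G : sgraph) (A B : {set G}).
Hypothesis AB0 : A :&: B = set0.

(** Other vertices are dropped because the sides of a [bipartition] cover the graph, and must keep
    the sizes of A and B. *)
Definition bip_vertex : finType := {x : G | x \in A :|: B}.

Definition bip_adj : rel bip_vertex := fun x y =>
  adj (val x) (val y) && ((val x \in A) == (val y \in B)).

Lemma bip_vertexE (x : bip_vertex) : (val x \in B) = (val x \notin A).
Proof.
case: x => x /= xAB; have := in_set0 x; rewrite -AB0 !inE in xAB *.
by move: xAB; case: (x \in A); case: (x \in B).
Qed.

Lemma bip_adj_sym : symmetric bip_adj.
Proof.
move=> x y; rewrite /bip_adj adj_sym !bip_vertexE.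
by case: (val x \in A); case: (val y \in A).
Qed.

Lemma bip_adj_irrefl : irreflexive bip_adj.
Proof. by move=> x; rewrite /bip_adj adj_irrefl. Qed.

Definition bip_graph := SGraph bip_adj_sym bip_adj_irrefl.

Definition bip_side (C : {set G}) : {set bip_graph} := [set x | val x \in C].

Lemma card_bip_side (C : {set G}) :
  C \subset A :|: B -> #|bip_side C| = #|C|.
Proof.
move=> /subsetP sC; rewrite -(card_imset _ val_inj); apply: eq_card => x.
apply/imsetP/idP => [[y]|xC]; first by rewrite inE => yC ->.
by exists (exist _ x (sC x xC)); rewrite ?inE.
Qed.

Lemma bipartition_bip_graph : bipartition (bip_side A) (bip_side B).
Proof.
split.
- by apply/setP=> x; rewrite !inE bip_vertexE andbN.
- by apply/setP=> x; rewrite !inE bip_vertexE orbN.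
- by move=> x y /andP[_ /eqP]; rewrite !inE.
Qed.

Lemma cross_pairs_bip_graph : #|cross_pairs A B| <= num_edges bip_graph.
Proof.
have [dis _ _] := bipartition_bip_graph.
apply: leq_trans (cross_pairs_le_edges dis).
pose f (p : bip_graph * bip_graph) := (val p.1, val p.2).
have finj : injective f by move=> [x y] [x' y'] [/val_inj-> /val_inj->].
rewrite -(card_imset _ finj); apply/subset_leq_card/subsetP => -[x y].
rewrite inE /= => /and3P[xA yB axy].
have xAB : x \in A :|: B by rewrite inE xA.
have yAB : y \in A :|: B by rewrite inE yB orbT.
apply/imsetP; exists ((exist _ x xAB : bip_graph), (exist _ y yAB : bip_graph)) => //.
by rewrite !inE /= xA yB /= /bip_adj /= axy xA yB.
Qed.

(** The inclusion of vertices sends cycles to cycles; being injective, it stays injective on edge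
    sets, two levels of images up. *)
Lemma num_cycles_bip_graph l : num_cycles bip_graph l <= num_cycles G l.
Proof.
pose f (e : {set bip_graph}) : {set G} := val @: e.
have finj : injective f by apply/imset_inj/val_inj.
rewrite /num_cycles -(card_imset _ (imset_inj finj)).
apply/subset_leq_card/subsetP => e.
case/imsetP=> _ /imsetP[c + ->] ->; rewrite !inE => /andP[cyc un].
apply/imsetP; exists (map_tuple val c).
  rewrite inE /ucycleb map_inj_uniq ?un ?andbT; last exact: val_inj.
  by apply: homo_cycle cyc => x y /andP[].
rewrite /cycle_edges /f /=; apply/setP=> s; apply/imsetP/imsetP.
  case=> _ /imsetP[x xc ->] ->; exists (val x); first exact: map_f.
  by rewrite imsetU1 imset_set1 (next_map val_inj un).
case=> _ /mapP[x xc ->] ->; exists [set x; next c x]; first exact: imset_f.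
by rewrite imsetU1 imset_set1 (next_map val_inj un).
Qed.

End BipartiteSubgraph.

(** * From a bound on indicator functions to an operator norm bound *)

Section DyadicForm.
Variable R : realType.

Definition l2 (T : finType) (f : T -> R) : R := Num.sqrt (\sum_x f x ^+ 2).

Lemma l2_ge0 (T : finType) (f : T -> R) : 0 <= l2 f.
Proof. exact: sqrtr_ge0. Qed.

Lemma sqr_l2 (T : finType) (f : T -> R) : l2 f ^+ 2 = \sum_x f x ^+ 2.
Proof. by rewrite sqr_sqrtr // sumr_ge0 // => x _; apply: sqr_ge0. Qed.

(* The level of [x] is the logarithm of its rank [r] in the decreasing order of
   the values of [f]; Chebyshev's inequality gives [f x <= l2 f / sqrt r]. *)
Lemma dyadic_levels (T : finType) (f : T -> R) : (forall x, 0 <= f x) ->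
  exists lev : T -> 'I_(trunc_log 2 #|T|).+1,
    (forall x, f x * Num.sqrt (2 ^+ lev x) <= l2 f) /\
    (forall j, (#|[set x | lev x == j]| <= 2 ^ j.+1)%N).
Proof.
move=> f0; pose rank x := #|[set y | f x <= f y]|.
have rank_gt0 x : (0 < rank x)%N by apply/card_gt0P; exists x; rewrite inE.
have ltL x : (trunc_log 2 (rank x) < (trunc_log 2 #|T|).+1)%N.
  by rewrite ltnS leq_trunc_log // max_card.
exists (fun x => Ordinal (ltL x)); split=> [x|j] /=.
  rewrite -[X in X * _](ger0_norm (f0 x)) -sqrtr_sqr -sqrtrM ?sqr_ge0 //.
  rewrite ler_wsqrtr //.
  apply: (@le_trans _ _ (f x ^+ 2 * (rank x)%:R)).
    by rewrite ler_wpM2l ?sqr_ge0 // -natrX ler_nat trunc_logP.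
  rewrite [leRHS](bigID (mem [set y | f x <= f y])) /=.
  apply: ler_wpDr; first by rewrite sumr_ge0 // => y _; apply: sqr_ge0.
  rewrite mulr_natr -sumr_const; apply: ler_sum => y; rewrite inE => xy.
  by rewrite ler_pXn2r // nnegrE.
have [->|[x0]] := set_0Vmem [set x | Ordinal (ltL x) == j]; first by rewrite cards0.
rewrite inE => x0j; pose P x := Ordinal (ltL x) == j.
(* The whole level has values at least the minimum f x, so the rank of x counts all of it. *)
have [x Px minx] := @arg_minP _ _ _ x0 P f x0j.
apply: (@leq_trans (rank x)).
  by apply/subset_leq_card/subsetP => y; rewrite !inE => /minx.
by rewrite -(eqP Px) /= ltnW // trunc_log_ltn.
Qed.

Variable G : sgraph.
Implicit Types f g : G -> R.

Definition adj_op f : G -> R := fun x => \sum_(y | adj x y) f y.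

Lemma adj_op_ge0 f : (forall x, 0 <= f x) -> forall x, 0 <= adj_op f x.
Proof. by move=> f0 x; apply: sumr_ge0. Qed.

Lemma iter_adj_op_ge0 n f :
  (forall x, 0 <= f x) -> forall x, 0 <= iter n adj_op f x.
Proof. by move=> f0; elim: n => //= n; apply: adj_op_ge0. Qed.

Lemma iter_adj_op_le n f g c : (forall x, f x <= c * g x) ->
  forall x, iter n adj_op f x <= c * iter n adj_op g x.
Proof.
move=> fg; elim: n => //= n IH x; rewrite /adj_op mulr_sumr.
exact: ler_sum.
Qed.

Lemma sum_cross_pairs (A B : {set G}) (c : R) :
  \sum_(x in A) \sum_(y | adj x y && (y \in B)) c = c * #|cross_pairs A B|%:R.
Proof.
rewrite card_cross_pairs natr_sum mulr_sumr; apply: eq_bigr => x _.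
rewrite natr_sum mulr_sumr big_mkcond [RHS]big_mkcond; apply: eq_bigr => y _.
by case: (y \in B); case: (adj x y); rewrite ?mulr1 ?mulr0.
Qed.

Variable lam : R.
Hypothesis lam_ge0 : 0 <= lam.
Hypothesis cross_le : forall A B : {set G},
  #|cross_pairs A B|%:R <= lam * Num.sqrt (#|A|%:R * #|B|%:R).

Let L : R := (trunc_log 2 #|G|).+1%:R.

(** On levels i and j, f and g are at most l2 f / w i and l2 g / w j, while [cross_le] allows at
    most lam * 2 * w i * w j pairs. The weights cancel, so each of the L^2 blocks obeys the same
    bound. *)
Lemma adj_form_le f g : (forall x, 0 <= f x) -> (forall x, 0 <= g x) ->
  \sum_x f x * adj_op g x <= 2 * lam * L ^+ 2 * (l2 f * l2 g).
Proof.
move=> f0 g0; have [a [fa ca]] := dyadic_levels f0.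
have [b [gb cb]] := dyadic_levels g0.
pose w (j : 'I_(trunc_log 2 #|G|).+1) : R := Num.sqrt (2 ^+ j).
have w_gt0 j : 0 < w j by rewrite sqrtr_gt0 exprn_gt0.
pose c i j := l2 f / w i * (l2 g / w j).
have c_ge0 i j : 0 <= c i j.
  by rewrite mulr_ge0 // divr_ge0 ?l2_ge0 // ltW.
apply: (@le_trans _ _ (\sum_x \sum_(y | adj x y) c (a x) (b y))).
  apply: ler_sum => x _; rewrite mulr_sumr; apply: ler_sum => y _.
  by rewrite ler_pM // ler_pdivlMr ?w_gt0.
have -> : \sum_x \sum_(y | adj x y) c (a x) (b y) =
    \sum_i \sum_j c i j * #|cross_pairs [set x | a x == i] [set y | b y == j]|%:R.
  rewrite (partition_big a predT) //=; apply: eq_bigr => i _.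
  under [RHS]eq_bigr => j _ do rewrite -sum_cross_pairs.
  rewrite exchange_big /=; apply: eq_big => [x|x /eqP ax]; first by rewrite inE.
  rewrite (partition_big b predT) //=; apply: eq_bigr => j _.
  by apply: eq_big => [y|y /andP[_ /eqP <-]]; rewrite ?inE // ax.
have -> : 2 * lam * L ^+ 2 * (l2 f * l2 g) =
    \sum_(i < (trunc_log 2 #|G|).+1) \sum_(j < (trunc_log 2 #|G|).+1)
      2 * lam * (l2 f * l2 g).
  by rewrite !sumr_const card_ord -mulrnA -[RHS]mulr_natr natrM -/L; lra.
apply: ler_sum => i _; apply: ler_sum => j _.
have s_le : Num.sqrt (#|[set x | a x == i]|%:R * #|[set y | b y == j]|%:R) <=
    2 * (w i * w j).
  rewrite /w -sqrtrM ?exprn_ge0 // -[X in _ <= X * _](ger0_norm (ler0n _ 2)).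
  rewrite -sqrtr_sqr -sqrtrM ?sqr_ge0 // ler_wsqrtr // -!natrX -!natrM ler_nat.
  apply: leq_trans (leq_mul (ca i) (cb j)) _.
  by rewrite !expnS mulnACA leqnn.
apply: (@le_trans _ _ (c i j * (lam * (2 * (w i * w j))))).
  rewrite ler_wpM2l //; apply: le_trans (cross_le _ _) _.
  by rewrite ler_wpM2l.
rewrite le_eqVlt; apply/orP; left; apply/eqP; rewrite /c.
rewrite [LHS](_ : _ = 2 * lam * (l2 f * l2 g) * (w i / w i) * (w j / w j)); last by lra.
by rewrite !divff ?gt_eqF // !mulr1.
Qed.

(** The form is tested against [adj_op g] itself, and one factor [l2 (adj_op g)] is cancelled when
    nonzero. *)
Lemma l2_adj_op_le g : (forall x, 0 <= g x) ->
  l2 (adj_op g) <= 2 * lam * L ^+ 2 * l2 g.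
Proof.
move=> g0; have Xg0 := adj_op_ge0 g0.
have := l2_ge0 (adj_op g); rewrite le_eqVlt => /orP[/eqP <-|pos].
  by rewrite !mulr_ge0 ?l2_ge0 // ler0n.
rewrite -(ler_pM2l pos) -expr2 sqr_l2.
apply: le_trans (_ : _ <= \sum_x adj_op g x * adj_op g x) _.
  by apply: ler_sum => x _; rewrite expr2.
by rewrite mulrCA; apply: adj_form_le.
Qed.

Lemma iter_adj_form_le n f : (forall x, 0 <= f x) ->
  \sum_x f x * iter n.+1 adj_op f x
    <= (2 * lam * L ^+ 2) ^+ n.+1 * \sum_x f x ^+ 2.
Proof.
move=> f0; set Lam := 2 * lam * L ^+ 2.
have Lam0 : 0 <= Lam by rewrite !mulr_ge0 ?exprn_ge0 // ler0n.
have IH : l2 (iter n adj_op f) <= Lam ^+ n * l2 f.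
  elim: n => [|n IH] /=; first by rewrite mul1r.
  apply: le_trans (l2_adj_op_le (iter_adj_op_ge0 n f0)) _.
  by rewrite -/Lam exprS -mulrA ler_wpM2l.
apply: le_trans (adj_form_le f0 (iter_adj_op_ge0 n f0)) _.
by rewrite -/Lam exprS -mulrA ler_wpM2l // -sqr_l2 expr2 mulrCA ler_wpM2l ?l2_ge0.
Qed.

End DyadicForm.

(** * Capped walks as a quadratic form in the square roots of degrees *)

Section CappedWalks.
Variables (R : realType) (G : sgraph).

(** The constraint P is kept only at the penultimate vertex z, whose deg z neighbours bound the
    choices of the last vertex. *)
Lemma card_bounded_walks (n : nat) (P : pred G) (x : G) : P x ->
  (#|[set p : n.+1.-tuple G | path (@adj G) x p && all P p]|)%:R
    <= iter n (@adj_op R G) (fun z => (P z)%:R * (deg z)%:R) x.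
Proof.
have consE N (F : pred (seq G)) : #|[set p : N.+1.-tuple G | F p]| =
    (\sum_(y : G) #|[set p : N.-tuple G | F (y :: p)]|)%N.
  under eq_bigr => y _ do rewrite -sum1dep_card.
  rewrite pair_big_dep /= -sum1dep_card.
  rewrite (reindex_onto (fun q : G * N.-tuple G => [tuple of q.1 :: q.2])
     (fun p => (thead p, [tuple of behead p]))) /=; last first.
    by move=> p _; apply/val_inj; rewrite /= [in RHS](tuple_eta p).
  apply: eq_bigl => -[y p] /=; rewrite theadE.
  by rewrite (_ : _ == _) ?andbT //; apply/eqP; congr pair; apply: val_inj.
elim: n x => [|n IH] x Px.
  rewrite /= Px mul1r ler_nat
    (consE _ (fun p => path (@adj G) x p && all P p)) /deg -sum1dep_card [leqRHS]big_mkcond /=.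
  apply: leq_sum => y _; case: (adj x y) => /=; last first.
    by rewrite leqn0 cards_eq0; apply/eqP/setP => p; rewrite !inE.
  by apply: leq_trans (max_card _) _; rewrite card_tuple expn0.
rewrite (consE _ (fun p => path (@adj G) x p && all P p)) natr_sum iterS /adj_op [leRHS]big_mkcond /=.
apply: ler_sum => y _; case: (adj x y) => /=; last first.
  by rewrite lern0 cards_eq0; apply/eqP/setP => p; rewrite !inE.
have [Py|nPy] := boolP (P y); last first.
  rewrite (_ : [set _ | _] = set0); last first.
    by apply/setP => p; rewrite !inE andbF.
  rewrite cards0; apply: iter_adj_op_ge0 => z.
  by rewrite mulr_ge0 ?ler0n.
exact: IH.
Qed.

Lemma capped_walks_le_form (succ : rel G) n : degree_order succ ->
  (num_capped_walks succ n.+1)%:R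
    <= \sum_x Num.sqrt ((deg x)%:R : R)
         * iter n (@adj_op R G) (fun z => Num.sqrt (deg z)%:R) x.
Proof.
case=> irr tr _ dsucc; pose P (x z : G) := (deg z <= deg x)%N.
have succP x z : succ x z -> P x z.
  move=> xz; rewrite /P leqNgt; apply/negP => /dsucc zx.
  by have := tr _ _ _ xz zx; rewrite irr.
apply: (@le_trans _ _ (\sum_x
    #|[set p : n.+1.-tuple G | path (@adj G) x p && all (P x) p]|%:R)).
  rewrite -natr_sum ler_nat.
  under eq_bigr => x _ do rewrite -sum1dep_card.
  rewrite pair_big_dep /= sum1dep_card.
  apply/subset_leq_card/subsetP => -[x p]; rewrite !inE /= => /andP[-> /=].
  exact/sub_all/succP.
apply: ler_sum => x _.
apply: le_trans (card_bounded_walks n (leqnn _ : P x x)) _.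
(* The factor sqrt (deg x) does not depend on z, so a pointwise comparison of weights suffices: deg
   z <= sqrt (deg x) * sqrt (deg z) when deg z <= deg x, and the weight is 0 otherwise. *)
apply: iter_adj_op_le => z; rewrite /P; case: leqP => zx /=; last first.
  by rewrite mul0r mulr_ge0 ?sqrtr_ge0.
rewrite mul1r -sqrtrM ?ler0n // -[leLHS](ger0_norm (ler0n _ _)) -sqrtr_sqr.
by rewrite ler_wsqrtr // expr2 ler_wpM2r ?ler0n // ler_nat.
Qed.

End CappedWalks.

(** * Supersaturation turned into a bound on crossing pairs *)

Section CrossPairsBound.
Variable R : realType.
Implicit Types a b c e q u x y : R.

Lemma rootK x n : 0 <= x -> (0 < n)%N -> (x `^ n%:R^-1) ^+ n = x.
Proof.
move=> x0 n0; rewrite -powR_mulrn ?powR_ge0 // -powRrM mulVf ?powRr1 //.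
by rewrite pnatr_eq0 -lt0n.
Qed.

(** This trades fractional exponents for natural powers of a root, making the later inequalities
    polynomial. *)
Lemma powR_ratio x i n : x `^ (i%:R / n%:R) = (x `^ n%:R^-1) ^+ i.
Proof. by rewrite mulrC powRrM powR_mulrn ?powR_ge0. Qed.

(* The three terms of the supersaturation threshold are played against the
   degree bounds [e <= q ^+ 2 * a], [e <= q ^+ 2 * b] and the trivial bound
   [e <= q ^+ k.+1] respectively. *)
Lemma subthreshold_le (k : nat) K e a b u q :
  1 <= K -> 0 <= e -> 0 <= a -> 0 <= b -> 0 <= u -> 0 <= q ->
  a * b = u ^+ (2 * k) ->
  3 * e <= K * (a + b + u ^+ k.+1) ->
  e <= q ^+ 2 * a -> e <= q ^+ 2 * b -> e <= q ^+ k.+1 ->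
  e <= K * (q * u ^+ k).
Proof.
move=> K1 e0 a0 b0 u0 q0 ab le3 ea eb eq.
have K0 : 0 <= K by apply: le_trans K1.
have rhs0 : 0 <= K * (q * u ^+ k) by rewrite !mulr_ge0 ?exprn_ge0.
(* Multiplying the two bounds gives e^2 <= K * q^2 * u^(2k), and K <= K^2; x and y are a and b in
   either order. *)
have unbal x y : 0 <= x -> 0 <= y -> x * y = u ^+ (2 * k) ->
    e <= K * x -> e <= q ^+ 2 * y -> e <= K * (q * u ^+ k).
  move=> x0 y0 xy ex ey; rewrite -(@ler_pXn2r _ 2) // ?nnegrE //.
  apply: (@le_trans _ _ ((K * x) * (q ^+ 2 * y))).
    by rewrite expr2 ler_pM.
  rewrite mulrACA xy mulnC exprM !exprMn mulrA ler_wpM2r ?sqr_ge0 //.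
  by rewrite ler_wpM2r ?sqr_ge0 // expr2 ler_peMl.
have [Ka|Ka] := leP e (K * a); first exact: unbal Ka eb.
have [Kb|Kb] := leP e (K * b).
  by apply: unbal Kb ea => //; rewrite mulrC.
(* Here K * a and K * b are both below e, so the third term must supply the rest of 3 * e. Then
   e^(k+1) is bounded by using this k times and e <= q^(k+1) once. *)
have Ku : e <= K * u ^+ k.+1 by lra.
rewrite -(@ler_pXn2r _ k.+1) // ?nnegrE //.
apply: (@le_trans _ _ ((K * u ^+ k.+1) ^+ k * q ^+ k.+1)).
  rewrite exprSr ler_pM ?exprn_ge0 // lerXn2r // ?nnegrE //.
  by rewrite mulr_ge0 ?exprn_ge0.
rewrite !exprMn -!exprM [(k * k.+1)%N]mulnC -mulrA.
rewrite [X in _ * X]mulrC ler_wpM2r //; first by rewrite mulr_ge0 ?exprn_ge0.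
by rewrite exprS ler_peMl ?exprn_ge0.
Qed.

(** Both variables are replaced by the larger one. With k = n + 2 the exponents k + 1 and k - 1 add
    up to 2k. *)
Lemma mixed_power_le n q x : 0 <= q -> 0 <= x ->
  q ^+ n.+3 * (q + x) ^+ n.+1 <= 2 ^+ n.+1 * (q ^+ (2 * n.+2) + x ^+ (2 * n.+2)).
Proof.
move=> q0 x0; have aux y z : 0 <= y -> 0 <= z -> y <= z ->
    forall v, 0 <= v -> v <= z -> v ^+ n.+3 * (y + z) ^+ n.+1 <= 2 ^+ n.+1 * z ^+ (2 * n.+2).
  move=> y0 z0 yz v v0 vz; rewrite (_ : 2 * n.+2 = n.+3 + n.+1)%N; last first.
    by rewrite [RHS]addSnnS mul2n addnn.
  rewrite exprD mulrCA -exprMn ler_pM ?exprn_ge0 ?addr_ge0 //.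
    by rewrite lerXn2r // nnegrE.
  by rewrite lerXn2r // ?nnegrE ?addr_ge0 ?mulr_ge0 //; lra.
have [qx|xq] := leP q x.
  apply: le_trans (aux q x q0 x0 qx q q0 qx) _.
  by rewrite ler_wpM2l ?exprn_ge0 // lerDr exprn_ge0.
rewrite [q + x]addrC; apply: le_trans (aux x q x0 q0 (ltW xq) q q0 (lexx _)) _.
by rewrite ler_wpM2l ?exprn_ge0 // lerDl exprn_ge0.
Qed.

(** The factor 2 absorbs the successor, since ln 2 <= ln n; at n = 1 the right side would be 0. *)
Lemma trunc_log_le_ln (n : nat) : (1 < n)%N ->
  (trunc_log 2 n).+1%:R <= 2 / ln 2 * ln (n%:R : R).
Proof.
move=> n1; have ln2 : 0 < ln (2 : R) by rewrite ln_gt0 // ltr1n.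
have le2 : ln (2 : R) <= ln n%:R by rewrite ler_ln ?posrE ?ltr0n ?ler_nat // ltnW.
have leT : (trunc_log 2 n)%:R * ln (2 : R) <= ln n%:R.
  rewrite mulr_natl -lnXn // -natrX ler_ln ?posrE ?ltr0n ?expn_gt0 ?(ltnW n1) //.
  by rewrite ler_nat trunc_logP // ltnW.
rewrite mulrAC ler_pdivlMr // -natr1; lra.
Qed.

Variables (k : nat) (c : R).
Hypotheses (k0 : (0 < k)%N) (c0 : 0 < c).
Hypothesis supersat : forall (G : sgraph) (A B : {set G}), bipartition A B ->
  100 * k%:R * (#|A|%:R + #|B|%:R + (#|A|%:R * #|B|%:R) `^ (k.+1%:R / (2 * k)%:R))
    <= (num_edges G)%:R :> R ->
  c * ((num_edges G)%:R ^+ (2 * k) / (#|A|%:R ^+ k * #|B|%:R ^+ k))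
    <= (num_cycles G (2 * k))%:R.

(** The hypothesis is applied to [bip_graph], which has at least as many edges as there are crossing
    pairs and no more cycles than G; nonempty sides allow the denominator to be cleared. *)
Lemma disjoint_supersaturation (G : sgraph) (A B : {set G}) :
  A :&: B = set0 -> (0 < #|A|)%N -> (0 < #|B|)%N ->
  100 * k%:R * (#|A|%:R + #|B|%:R + (#|A|%:R * #|B|%:R) `^ (k.+1%:R / (2 * k)%:R))
    <= #|cross_pairs A B|%:R :> R ->
  c * #|cross_pairs A B|%:R ^+ (2 * k)
    <= (num_cycles G (2 * k))%:R * (#|A|%:R * #|B|%:R) ^+ k.
Proof.
move=> AB0 A0 B0 thr; have := supersat (bipartition_bip_graph AB0).
rewrite !card_bip_side ?subsetUl ?subsetUr // => sup.
have leE : (#|cross_pairs A B|%:R : R) <= (num_edges (bip_graph AB0))%:R.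
  by rewrite ler_nat cross_pairs_bip_graph.
have leT : ((num_cycles (bip_graph AB0) (2 * k))%:R : R)
    <= (num_cycles G (2 * k))%:R.
  by rewrite ler_nat num_cycles_bip_graph.
have {sup} /le_trans/(_ leT) := sup (le_trans thr leE).
rewrite mulrA -exprMn ler_pdivrMr; last by rewrite exprn_gt0 // mulr_gt0 ?ltr0n.
apply: le_trans; by rewrite ler_wpM2l ?(ltW c0) // lerXn2r ?nnegrE ?ler0n.
Qed.

Variable G : sgraph.
Local Notation m := ((num_edges G)%:R : R).
Local Notation t := ((num_cycles G (2 * k))%:R : R).
Hypothesis max_deg_le : (max_deg G)%:R <= m `^ (2 / k.+1%:R).

(** The first term is 3 times the threshold constant, one share per threshold term; the second comes
    from taking 2k-th roots in supersaturation. *)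
Definition cross_const : R := 300 * k%:R + c^-1 `^ (2 * k)%:R^-1.

Lemma cross_const_gt0 : 0 < cross_const.
Proof. by rewrite ltr_wpDr ?powR_ge0 // mulr_gt0 ?ltr0n. Qed.

Definition cross_scale : R := m `^ k.+1%:R^-1 + t `^ (2 * k)%:R^-1.

Lemma cross_scale_ge0 : 0 <= cross_scale.
Proof. by rewrite addr_ge0 ?powR_ge0. Qed.

Lemma cross_pairs_disjoint_le (A B : {set G}) : A :&: B = set0 ->
  #|cross_pairs A B|%:R
    <= cross_const * cross_scale * Num.sqrt (#|A|%:R * #|B|%:R).
Proof.
move=> AB0; have := cross_pairs_le_edges AB0.
have := cross_pairs_le_deg A B; have := cross_pairs_le_deg B A.
rewrite (cross_pairsC B A).
have [->|A0] := posnP #|A|.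
  by rewrite muln0 leqn0 => _ /eqP -> _; rewrite mul0r sqrtr0 mulr0.
have [->|B0] := posnP #|B|.
  by rewrite muln0 leqn0 => /eqP -> _ _; rewrite mulr0 sqrtr0 mulr0.
have k20 : (0 < 2 * k)%N by rewrite muln_gt0.
have thr := @disjoint_supersaturation G A B AB0 A0 B0.
move: #|cross_pairs A B| thr => e thr eB eA em.
rewrite /cross_const /cross_scale.
set a : R := #|A|%:R in thr *; set b : R := #|B|%:R in thr *.
have a0 : 0 <= a by rewrite ler0n.
have b0 : 0 <= b by rewrite ler0n.
(* With this root, sqrt (a * b) is u^k and the power in the threshold is u^(k+1). *)
pose u := (a * b) `^ (2 * k)%:R^-1.
have u0 : 0 <= u by rewrite powR_ge0.
have uE : u ^+ (2 * k) = a * b by rewrite rootK // mulr_ge0.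
have -> : Num.sqrt (a * b) = u ^+ k.
  by rewrite -uE mulnC exprM sqrtr_sqr ger0_norm ?exprn_ge0.
rewrite powR_ratio -/u in thr.
set q := m `^ k.+1%:R^-1; set tau := t `^ _; set g := c^-1 `^ _.
have q0 : 0 <= q by rewrite powR_ge0.
have tau0 : 0 <= tau by rewrite powR_ge0.
have g0 : 0 <= g by rewrite powR_ge0.
have qE : q ^+ k.+1 = m by rewrite rootK ?ler0n.
have K1 : 1 <= 300 * k%:R :> R.
  by rewrite -natrM ler1n muln_gt0.
have dq : (max_deg G)%:R <= q ^+ 2 by rewrite -powR_ratio.
(* Above the threshold, supersaturation gives the tau term; below it, the degree and edge bounds
   give the q term. *)
have [sup|sub] := leP (100 * k%:R * (a + b + u ^+ k.+1)) e%:R.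
  have {}thr := thr sup.
  apply: (@le_trans _ _ (g * tau * u ^+ k)).
    rewrite -(@ler_pXn2r _ (2 * k)) ?nnegrE ?ler0n ?mulr_ge0 ?exprn_ge0 //.
    rewrite !exprMn rootK ?ler0n ?invr_ge0 ?(ltW c0) // rootK ?ler0n //.
    by rewrite -exprM [(k * _)%N]mulnC [u ^+ _]exprM uE -mulrA ler_pdivlMl.
  rewrite ler_wpM2r ?exprn_ge0 //; have : 0 <= 300 * k%:R :> R by lra.
  move=> K0; rewrite ler_pM // ?lerDr //.
apply: (@le_trans _ _ (300 * k%:R * (q * u ^+ k))).
  apply: (subthreshold_le K1 _ a0 b0 u0 q0); rewrite ?ler0n ?uE //.
  - lra.
  - apply: (@le_trans _ _ ((max_deg G)%:R * a)).
      by rewrite -natrM ler_nat.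
    by rewrite ler_wpM2r.
  - apply: (@le_trans _ _ ((max_deg G)%:R * b)).
      by rewrite -natrM ler_nat.
    by rewrite ler_wpM2r.
  - by rewrite qE ler_nat.
rewrite mulrA ler_wpM2r ?exprn_ge0 // ler_pM ?lerDl //; lra.
Qed.

Lemma cross_pairs_le (A B : {set G}) :
  #|cross_pairs A B|%:R
    <= 4 * (cross_const * cross_scale) * Num.sqrt (#|A|%:R * #|B|%:R).
Proof.
have [P le4] := cross_pairs_cut A B.
have dis : (A :&: P) :&: (B :\: P) = set0.
  by apply/setP=> x; rewrite !inE; case: (x \in P); rewrite ?andbF.
apply: (@le_trans _ _ (4 * #|cross_pairs (A :&: P) (B :\: P)|%:R)).
  by rewrite -natrM ler_nat.
rewrite -mulrA ler_wpM2l //; apply: le_trans (cross_pairs_disjoint_le dis) _.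
rewrite ler_wpM2l ?mulr_ge0 ?cross_scale_ge0 ?(ltW cross_const_gt0) //.
rewrite ler_wsqrtr // -!natrM ler_nat leq_mul // subset_leq_card //.
  exact: subsetIl.
exact: subsetDl.
Qed.

End CrossPairsBound.

(** * Degree sums and the final assembly *)

(** A good cut of the whole vertex set gives 4 where handshaking gives 2, which only affects the
    constant. *)
Lemma sum_deg_le (G : sgraph) : (\sum_(x : G) deg x <= 4 * num_edges G)%N.
Proof.
rewrite sum_deg; have [P /leq_trans->//] := cross_pairs_cut [set: G] setT.
rewrite leq_mul2l cross_pairs_le_edges ?orbT //.
by apply/setP=> x; rewrite !inE; case: (x \in P).
Qed.

Lemma sum_deg_card_le1 (G : sgraph) :
  (#|G| <= 1)%N -> (\sum_(x : G) deg x = 0)%N.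
Proof.
move=> /fintype_le1P G1; apply: big1 => x _; apply/eqP; rewrite cards_eq0.
by apply/eqP/setP=> y; rewrite !inE (G1 x y) adj_irrefl.
Qed.

Theorem theoremA3 (R : realType) (k : nat) (hk : (2 <= k)%N)
  (hUSC : unbalanced_supersaturation R k) :
  exists (C : R) (d : nat), 0 < C /\
    forall (G : sgraph) (succ : rel G), degree_order succ ->
      let m : R := (num_edges G)%:R in
      let t : R := (num_cycles G (2 * k))%:R in
      (max_deg G)%:R <= m `^ (2 / k.+1%:R) ->
      (num_capped_walks succ k)%:R
        <= C * ln (#|G|%:R : R) ^+ d * (m `^ ((2 * k)%:R / k.+1%:R) + t).
Proof.
case: k hk hUSC => [|[|n]] // _ [c [c0 supersat]].
have [K [K0 cross_le]] : exists K : R, 0 < K /\ forall G : sgraph,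
    (max_deg G)%:R <= (num_edges G)%:R `^ (2 / n.+3%:R) :> R ->
    forall A B : {set G},
    #|cross_pairs A B|%:R
      <= 4 * (K * cross_scale R n.+2 G) * Num.sqrt (#|A|%:R * #|B|%:R).
  exists (cross_const n.+2 c); split; first exact: cross_const_gt0.
  by move=> G dle; apply: cross_pairs_le.
have [D [D0 log_le]] : exists D : R, 0 < D /\
    forall N : nat, (1 < N)%N -> (trunc_log 2 N).+1%:R <= D * ln N%:R.
  exists (2 / ln 2); split; last exact: trunc_log_le_ln.
  by rewrite divr_gt0 // ln_gt0 // ltr1n.
(* Here k = n + 2. Each of the k - 1 applications of X costs 2 * lam * L^2 with lam = 4 * K * s and
   L <= D * l; the outer 4 is from [sum_deg_le], the power of 2 from [mixed_power_le]. *)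
exists (4 * (8 * K * D ^+ 2) ^+ n.+1 * 2 ^+ n.+1), (2 * n.+1)%N; split.
  by rewrite !(mulr_gt0, exprn_gt0).
move=> G succ ord m t dle; set l := ln _.
pose s := cross_scale R n.+2 G.
have s0 : 0 <= s by apply: cross_scale_ge0.
have lam0 : 0 <= 4 * (K * s) by rewrite !mulr_ge0 // ltW.
have deg0 (x : G) : 0 <= Num.sqrt ((deg x)%:R : R) by apply: sqrtr_ge0.
have := iter_adj_form_le lam0 (cross_le G dle) n deg0.
move=> /(le_trans (capped_walks_le_form R n.+1 ord)).
under [X in _ * X]eq_bigr => x _ do rewrite sqr_sqrtr ?ler0n //.
rewrite -natr_sum.
have le0 : 0 <= l ^+ (2 * n.+1) by rewrite mulnC exprM sqr_ge0.
(* On at most one vertex L = 1 is not controlled by the logarithm, but all degrees vanish. *)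
have [G1|G1] := leqP #|G| 1.
  rewrite sum_deg_card_le1 // mulr0 => /le_trans-> //.
  rewrite mulr_ge0 ?addr_ge0 ?powR_ge0 ?ler0n // mulr_ge0 // ltW //.
  by rewrite !(mulr_gt0, exprn_gt0).
set L := (trunc_log 2 #|G|).+1%:R => /le_trans-> //.
have leL : L <= D * l by apply: log_le.
have q0 : 0 <= m `^ n.+3%:R^-1 by apply: powR_ge0.
have tau0 : 0 <= t `^ (2 * n.+2)%:R^-1 by apply: powR_ge0.
(* After the roots collapse, this bounds m * s^(k-1), because q^(k+1) = m and tau^(2k) = t. *)
have mix := mixed_power_le n q0 tau0.
rewrite !rootK ?ler0n // -powR_ratio -/s in mix.
apply: (@le_trans _ _ ((8 * K * D ^+ 2 * (l ^+ 2 * s)) ^+ n.+1 * (4 * m))).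
  apply: ler_pM; rewrite ?ler0n ?exprn_ge0 //.
  - by rewrite !mulr_ge0 ?ler0n ?exprn_ge0 // ltW.
  - rewrite lerXn2r ?nnegrE //.
    + by rewrite !mulr_ge0 ?ler0n ?exprn_ge0 // ltW.
    + rewrite mulr_ge0 //; last by rewrite mulr_ge0 ?sqr_ge0.
      by rewrite !mulr_ge0 ?exprn_ge0 // ltW.
    rewrite (_ : 2 * _ * _ = 8 * K * s * L ^+ 2); last by lra.
    rewrite (_ : 8 * K * D ^+ 2 * _ = 8 * K * s * (D * l) ^+ 2); last by lra.
    rewrite ler_wpM2l ?mulr_ge0 ?(ltW K0) // lerXn2r ?nnegrE ?ler0n //.
    by apply: le_trans leL; rewrite ler0n.
  - by rewrite -natrM ler_nat sum_deg_le.
have M0 : 0 <= (8 * K * D ^+ 2) ^+ n.+1.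
  by rewrite exprn_ge0 // !mulr_ge0 ?exprn_ge0 // ltW.
rewrite exprMn; move: (_ ^+ n.+1) M0 => M M0; rewrite exprMn -exprM.
rewrite [leLHS](_ : _ = 4 * M * l ^+ (2 * n.+1) * (m * s ^+ n.+1)); last by lra.
rewrite [leRHS](_ : _ = 4 * M * l ^+ (2 * n.+1)
    * (2 ^+ n.+1 * (m `^ ((2 * n.+2)%:R / n.+3%:R) + t))); last by lra.
by rewrite ler_wpM2l // mulr_ge0 // mulr_ge0.
Qed.
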